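(* Let $g$ be a non-decreasing balancing function with $g(s)\le\overline\lambda$ for all $s\geq 0$, for some $\overline\lambda<\infty$. Let $L$ be the generator of the associated locally-balanced jump process, $$Lf(x)=\int_E(f(y)-f(x))\,g(t(x,y))\,\gamma(x,dy),$$ and let $P$ be the Metropolis--Hastings transition kernel $$P(x,dy)=\min(1,t(x,y))\,\gamma(x,dy)+\left(\int_E(1-\min(1,t(x,z)))\,\gamma(x,dz)\right)\delta_x(dy).$$ Then the locally-balanced jump process has a positive spectral gap $\gamma_L>0$ if and only if the Metropolis--Hastings chain does, i.e. $\gamma_P>0$. The same equivalence holds for the spectral gap over $L^2(\pi)$: $\mathrm{G}(L)>0$ if and only if $\mathrm{G}(P)>0$.
   Context: Let $E$ be a Polish space with Borel $\sigma$-algebra $\mathcal{E}$, $\pi$ a probability measure on $(E,\mathcal{E})$, and $\gamma:E\times\mathcal{E}\to[0,1]$ a Markov kernel. Write $[\pi\otimes\gamma](dx,dy)=\pi(dx)\gamma(x,dy)$. The function $t:E\times E\to[0,\infty)$ is a version of the Radon--Nikodym derivative $t(x,y)=\frac{\pi(dy)\gamma(y,dx)}{\pi(dx)\gamma(x,dy)}$ such that, for some measurable $R\subset E\times E$ with $[\pi\otimes\gamma](R)=1$, one has $0<t(x,y)<\infty$ and $t(y,x)=1/t(x,y)$ for $(x,y)\in R$, and $t(x,y)=0$ for $(x,y)\notin R$. A balancing function is a (Borel) function $g:[0,\infty)\to[0,\infty)$ with $g(1)=1$, $g(0)=0$, $g(s)>0$ for $s>0$, and $g(s)=s\,g(1/s)$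 for all $s>0$. Let $\langle f,h\rangle_\pi=\int_E fh\,d\pi$ and let $\mathcal{B}(E)$ be the bounded measurable functions on $E$. For the generator $L$: $\mathcal{E}(L,f)=\langle f,-Lf\rangle_\pi$, $\gamma_L=\inf_{f\in\mathcal{B}(E)}\mathcal{E}(L,f)/\mathrm{Var}_\pi(f)$ and $\mathrm{G}(L)=\inf_{f\in L^2(\pi)}\mathcal{E}(L,f)/\mathrm{Var}_\pi(f)$. For the Markov kernel $P$, $\gamma_P$ and $\mathrm{G}(P)$ are defined in the same way with $-L$ replaced by $I-P$, i.e. with the form $\langle f,(I-P)f\rangle_\pi$. All infima are over $f$ with $\mathrm{Var}_\pi(f)>0$. *)

(* Defs.v *)
From HB Require Import structures.
From mathcomp Require Import all_boot all_order all_algebra.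
From mathcomp Require Import all_classical all_reals all_analysis.
From mathcomp Require Import measurable_realfun.

Set Implicit Arguments.
Unset Strict Implicit.
Unset Printing Implicit Defensive.

Import Order.TTheory GRing.Theory Num.Theory.
Import numFieldNormedType.Exports.

Local Open Scope classical_set_scope.
Local Open Scope ring_scope.

#[short(type="completeMetricType")]
HB.structure Definition CompleteMetric (R : numDomainType) :=
  {T of Metric R T & Complete T}.

Definition separable_space (T : topologicalType) : Prop :=
  exists2 D : set T, countable D & dense D.

Definition polish_space (R : realType) (E : topologicalType) : Prop :=
  exists (M : completeMetricType R) (phi : E -> M) (psi : M -> E),
    [/\ cancel phi psi, cancel psi phi, continuous phi, continuous psi
      & separable_space M].

Notation borel E := (g_sigma_algebraType (@open E)).

Section semidirect_product.
Context d (E : measurableType d) (R : realType).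
Local Open Scope ereal_scope.

(* pi(dx) gamma(x, dy) *)
Definition sdprod (pi : probability E R) (gamma : R.-pker E ~> E)
    (A : set (E * E)) : \bar R :=
  \int[pi]_x gamma x (xsection A x).

Variables (pi : probability E R) (gamma : R.-pker E ~> E).

Let mxsec A : measurable A ->
  measurable_fun [set: E] (fun x => gamma x (xsection A x)).
Proof.
by move=> mA; apply: measurable_fun_xsection_finite_kernel; rewrite inE.
Qed.

Let sdprod0 : sdprod pi gamma set0 = 0.
Proof. by apply: integral0_eq => x _; rewrite xsection0 measure0. Qed.

Let sdprod_ge0 A : 0 <= sdprod pi gamma A.
Proof. exact: integral_ge0. Qed.

Let sdprod_sigma_additive : semi_sigma_additive (sdprod pi gamma).
Proof.
move=> F mF tF mUF; rewrite [X in _ --> X](_ : _ =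
    \int[pi]_x (\sum_(n <oo) gamma x (xsection (F n) x))); last first.
  apply: eq_integral => x _; apply/esym/cvg_lim => //.
  rewrite xsection_bigcup.
  apply: (@measure_semi_sigma_additive _ _ _ (gamma x)
    (fun n => xsection (F n) x)).
  - by move=> n; exact: measurable_xsection.
  - exact: trivIset_xsection.
  - by apply: bigcup_measurable => n _; exact: measurable_xsection.
apply/cvg_closeP; split.
  by apply: is_cvg_nneseries => n _ _; exact: integral_ge0.
rewrite closeE// integral_nneseries// => n.
exact: mxsec.
Qed.

HB.instance Definition _ := isMeasure.Build _ _ R (sdprod pi gamma)
  sdprod0 sdprod_ge0 sdprod_sigma_additive.

Let sdprod_setT : sdprod pi gamma [set: E * E] = 1.
Proof.
rewrite /sdprod (eq_integral (cst 1)); last first.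
  by move=> x _; rewrite xsectionE preimage_setT prob_kernel.
by rewrite integral_cst//= mul1e probability_setT.
Qed.

HB.instance Definition _ := Measure_isProbability.Build _ _ R
  (sdprod pi gamma) sdprod_setT.

End semidirect_product.


Definition radon_nikodym_version d (T : measurableType d) (R : realType)
    (nu mu : set T -> \bar R) (t : T -> R) : Prop :=
  forall A, measurable A -> nu A = (\int[mu]_(z in A) (t z)%:E)%E.

(* The pushforward is the measure pi(dy) gamma(y, dx). *)
Definition acceptance_ratio d (E : measurableType d) (R : realType)
    (pi : probability E R) (gamma : R.-pker E ~> E) (t : E * E -> R) : Prop :=
  radon_nikodym_version (pushforward (sdprod pi gamma) (fun z => (z.2, z.1)))
    (sdprod pi gamma) t /\
  exists S : set (E * E),
    [/\ measurable S, sdprod pi gamma S = 1%E,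
        forall x y, S (x, y) -> 0 < t (x, y) /\ t (y, x) = 1 / t (x, y)
      & forall x y, ~ S (x, y) -> t (x, y) = 0].

Record balancing_function (R : realType) (g : R -> R) : Prop := {
  balancing_measurable : measurable_fun (`[0, +oo[ : set R) g ;
  balancing_ge0 : forall s : R, 0 <= s -> 0 <= g s ;
  balancing1 : g 1 = 1 ;
  balancing0 : g 0 = 0 ;
  balancing_gt0 : forall s : R, 0 < s -> 0 < g s ;
  balancingE : forall s : R, 0 < s -> g s = s * g (1 / s) }.

Definition lb_generator d (E : measurableType d) (R : realType)
    (gamma : R.-pker E ~> E) (t : E * E -> R) (g : R -> R)
    (f : E -> R) (x : E) : R :=
  \int[gamma x]_y ((f y - f x) * g (t (x, y))).

Section metropolis_hastings.
Context d (E : measurableType d) (R : realType).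
Local Open Scope ereal_scope.

(* The proofs [mt] and [t0] are arguments so that the measure structure below
   can be inferred. *)
Definition mh (gamma : R.-pker E ~> E) (t : E * E -> R)
    (mt : measurable_fun [set: E * E] t) (t0 : forall z, (0 <= t z)%R)
    (x : E) (A : set E) : \bar R :=
  \int[gamma x]_(y in A) (Num.min 1 (t (x, y)))%:E +
  (\int[gamma x]_z (1 - Num.min 1 (t (x, z)))%:E) * \d_x A.

Variables (gamma : R.-pker E ~> E) (t : E * E -> R).
Hypotheses (mt : measurable_fun [set: E * E] t) (t0 : forall z, (0 <= t z)%R).

Let a (z : E * E) : R := Num.min 1%R (t z).

Let a_ge0 z : (0 <= a z)%R.
Proof. by rewrite /a le_min ler01 t0. Qed.

Let a_le1 z : (a z <= 1)%R.
Proof. by rewrite /a ge_min lexx. Qed.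

Let ma : measurable_fun [set: E * E] a.
Proof. exact: measurable_minr. Qed.

Let ma1 x : measurable_fun [set: E] (fun y => a (x, y)).
Proof. exact: measurableT_comp. Qed.

Let rej x : \bar R := \int[gamma x]_z (1 - a (x, z))%:E.

Let rej_ge0 x : 0 <= rej x.
Proof. by apply: integral_ge0 => z _; rewrite lee_fin subr_ge0. Qed.

Let rej_fin x : rej x \is a fin_num.
Proof.
rewrite ge0_fin_numE//; apply: (@le_lt_trans _ _ (\int[gamma x]_z (cst 1 z))).
  apply: ge0_le_integral => //.
  - by move=> z _; rewrite lee_fin subr_ge0.
  - by apply/measurable_EFinP; exact: measurable_funB.
  - by move=> z _; rewrite lee_fin gerBl.
by rewrite integral_cst// mul1e prob_kernel ltry.
Qed.

Let mh0 x : mh gamma mt t0 x set0 = 0.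
Proof. by rewrite /mh integral_set0 measure0 mule0 adde0. Qed.

Let mh_ge0 x A : 0 <= mh gamma mt t0 x A.
Proof.
apply: adde_ge0; first by apply: integral_ge0 => y _; rewrite lee_fin a_ge0.
by apply: mule_ge0 => //; exact: rej_ge0.
Qed.

Let mh_sigma_additive x : semi_sigma_additive (mh gamma mt t0 x).
Proof.
move=> F mF tF mUF.
rewrite [X in _ --> X](_ : _ =
    \sum_(n <oo) mh gamma mt t0 x (F n)); last first.
  rewrite /mh ge0_integral_bigcup//; last 2 first.
    - by apply: measurable_funTS; apply/measurable_EFinP; exact: ma1.
    - by move=> y _; rewrite lee_fin a_ge0.
  rewrite [RHS](@nneseriesD _
      (fun n => \int[gamma x]_(y in F n) (a (x, y))%:E)
      (fun n => rej x * \d_x (F n)) xpredT 0); last 2 first.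
    - by move=> n _ _; apply: integral_ge0 => y _; rewrite lee_fin a_ge0.
    - by move=> n _ _; apply: mule_ge0 => //; exact: rej_ge0.
  congr (_ + _); rewrite -/(rej x) -(fineK (rej_fin x)) nneseriesZl//.
  congr (_ * _); apply/esym/cvg_lim => //.
  exact: (@measure_semi_sigma_additive _ _ _ (dirac x) F).
by apply: is_cvg_nneseries => n _ _; exact: mh_ge0.
Qed.

HB.instance Definition _ x := isMeasure.Build _ _ R (mh gamma mt t0 x)
  (mh0 x) (@mh_ge0 x) (@mh_sigma_additive x).

Definition mh_kernel : E -> {measure set E -> \bar R} := mh gamma mt t0.

Let mh_measurable U : measurable U ->
  measurable_fun [set: E] (mh_kernel ^~ U).
Proof.
move=> mU; apply: emeasurable_funD.
  rewrite (_ : (fun x => _) =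
      fun x => \int[gamma x]_y (a (x, y) * \1_U y)%:E); last first.
    apply/funext => x; rewrite integral_mkcond.
    apply: eq_integral => y _; rewrite patchE indicE.
    by case: ifPn => _; rewrite ?mulr1 ?mulr0.
  apply: (measurable_fun_integral_finite_kernel
    (fun z => (a z * \1_U z.2)%:E)).
    by move=> z; rewrite lee_fin mulr_ge0// a_ge0.
  apply/measurable_EFinP; apply: measurable_funM => //.
  apply: (measurableT_comp (f := \1_U : E -> R)) => //.
apply: emeasurable_funM.
  apply: (measurable_fun_integral_finite_kernel (fun z => (1 - a z)%:E)).
    by move=> z; rewrite lee_fin subr_ge0.
  by apply/measurable_EFinP; exact: measurable_funB.
by apply/measurable_EFinP; exact: measurable_indic.
Qed.

HB.instance Definition _ := isKernel.Build _ _ _ _ _ mh_kernel mh_measurable.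

Let mh_prob x : mh_kernel x [set: E] = 1.
Proof.
rewrite /mh_kernel/= /mh diracT mule1 -ge0_integralD//; last 4 first.
- by move=> y _; rewrite lee_fin a_ge0.
- by apply/measurable_EFinP; exact: ma1.
- by move=> y _; rewrite lee_fin subr_ge0 a_le1.
- by apply/measurable_EFinP; apply: measurable_funB => //; exact: ma1.
rewrite (eq_integral (cst 1)); last first.
  by move=> y _; rewrite /= -EFinD addrC subrK.
by rewrite integral_cst// mul1e; exact: prob_kernel.
Qed.

HB.instance Definition _ := Kernel_isProbability.Build _ _ _ _ _
  mh_kernel mh_prob.

End metropolis_hastings.

Section spectral_gaps.
Context d (E : measurableType d) (R : realType).
Variable pi : probability E R.

Definition inner (f h : E -> R) : R := \int[pi]_x (f x * h x).

Definition dirichlet_generator (L : (E -> R) -> E -> R) (f : E -> R) : R :=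
  inner f (fun x => - L f x).

Definition dirichlet_kernel (P : R.-pker E ~> E) (f : E -> R) : R :=
  inner f (fun x => f x - \int[P x]_y f y).

Definition bounded_measurable : set (E -> R) :=
  [set f : E -> R | measurable_fun [set: E] f /\ bounded_fun f].

Definition square_integrable : set (E -> R) :=
  [set f : E -> R | f \in Lfun pi 2%:E].

(* The infimum is taken in the extended reals; it is +oo if no function of
   [F] has positive variance. *)
Definition poincare_inf (form : (E -> R) -> R) (F : set (E -> R)) : \bar R :=
  ereal_inf [set (form f / fine (variance pi f))%:E |
    f in [set f | F f /\ (0 < variance pi f)%E]].

Definition gap_generator (L : (E -> R) -> E -> R) : \bar R :=
  poincare_inf (dirichlet_generator L) bounded_measurable.

Definition gapL2_generator (L : (E -> R) -> E -> R) : \bar R :=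
  poincare_inf (dirichlet_generator L) square_integrable.

Definition gap_kernel (P : R.-pker E ~> E) : \bar R :=
  poincare_inf (dirichlet_kernel P) bounded_measurable.

Definition gapL2_kernel (P : R.-pker E ~> E) : \bar R :=
  poincare_inf (dirichlet_kernel P) square_integrable.

End spectral_gaps.

(* Main.v *)
Require Import Defs.
From mathcomp Require Import all_boot all_order all_algebra.
From mathcomp Require Import all_classical all_reals all_analysis.
From mathcomp Require Import measurable_realfun.
From mathcomp Require Import ring lra.
Import Order.TTheory GRing.Theory Num.Theory.
Import numFieldNormedType.Exports.
Local Open Scope classical_set_scope.
Local Open Scope ring_scope.

(** Both Dirichlet forms are energies of reversible jump processes driven by
    the same proposals, and the two jump rates are comparable pointwise.

    Let [mu = sdprod pi gamma].  The ratio [t] satisfies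
    [t(x, y) g(t(y, x)) = g(t(x, y))] for every balancing function [g]; since
    [t] is the density with respect to [mu] of its image under the exchange of
    coordinates, the measure [g(t) mu] is symmetric
    ([symmetric_balanced_rate]).  For a bounded symmetric rate [c] and [f] in
    [L^2(pi)], expanding the square then gives
<<
      <f, -L_c f> = 1/2 \int c(x, y) (f y - f x)^2 mu(dx, dy)
>>
    for the jump generator [L_c] of rate [c] ([dirichlet_jump_generator]).

    The Metropolis-Hastings chain fits the same picture: a rejected proposal
    does not move the state, hence [f - P f = - L_a f] with [a = min(1, t)]
    ([Rintegral_mh], [dirichlet_kernel_mh]), and [min(1, .)] is itself a
    balancing function.

    Finally, monotonicity, the identity [g(s) = s g(1/s)] and the bound
    [g <= lambda] give [min(1, s) <= g(s) <= lambda min(1, s)]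
    ([balancing_ge_min], [balancing_le_min]).  So the two forms agree up to
    the factor [lambda] on [L^2(pi)] ([dirichlet_comparison]), and therefore
    over any class of square-integrable functions one Poincare infimum is
    positive when the other is ([gap_equivalence]).

    The integrals against [mu], against its exchanged image and against
    [P(x, .)] are all computed by disintegration
    ([ge0_integral_mixture]). *)

Set Implicit Arguments.
Unset Strict Implicit.
Unset Printing Implicit Defensive.

(** * Disintegration of integrals *)

Section integral_mixture.
Context d1 d2 {X : measurableType d1} {Z : measurableType d2} {R : realType}.
Variables (mu : {measure set X -> \bar R}) (nu : {measure set Z -> \bar R}).
Variable k : X -> {measure set Z -> \bar R}.
Hypothesis mk : forall U, measurable U -> measurable_fun [set: X] (k ^~ U).
Hypothesis nuE : forall U, measurable U -> nu U = (\int[mu]_x k x U)%E.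
Local Open Scope ereal_scope.
Import HBNNSimple.

Let mixture_nnsfun (f : {nnsfun Z >-> R}) :
  \int[nu]_z (f z)%:E = \int[mu]_x \int[k x]_z (f z)%:E.
Proof.
under [RHS]eq_integral do rewrite integralT_nnsfun sintegralE.
rewrite integralT_nnsfun sintegralE.
rewrite ge0_integral_fsum//; last 2 first.
- by move=> r; apply: measurable_funeM; exact: mk.
- move=> r x _; have [r0|r0] := leP 0%R r; first by rewrite mule_ge0.
  by rewrite preimage_nnfun0// measure0 mule0.
apply: eq_fsbigr => r _; rewrite nuE//.
have [r0|r0] := leP 0%R r; first by rewrite ge0_integralZl//; exact: mk.
rewrite preimage_nnfun0//.
by rewrite !integral0_eq ?mule0// => x _; rewrite measure0 ?mule0.
Qed.

(** Integrating against a mixture [nu = \int k(x, .) mu(dx)] is integrating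
    in two stages; the hypothesis is the case of indicators, and monotone
    approximation by simple functions does the rest.  Three mixtures are used
    below: slices of a semidirect product, weighted Dirac masses (a density),
    and the accept-reject step of Metropolis-Hastings. *)
Lemma ge0_integral_mixture (f : Z -> \bar R) :
  (forall z, 0 <= f z) -> measurable_fun [set: Z] f ->
  \int[nu]_z f z = \int[mu]_x \int[k x]_z f z.
Proof.
move=> f0 mf; pose f_ := nnsfun_approx measurableT mf.
have mono (m : {measure set Z -> \bar R}) :
    \int[m]_z f z = limn (fun n => \int[m]_z (f_ n z)%:E).
  rewrite -monotone_convergence//.
  - apply: eq_integral => z _; apply/esym/cvg_lim => //.
    exact: cvg_nnsfun_approx.
  - by move=> n; exact/measurable_EFinP.
  - by move=> n z _; rewrite lee_fin.
  - by move=> z _ a b ab; rewrite lee_fin; exact/lefP/nd_nnsfun_approx.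
rewrite mono; under eq_fun do rewrite mixture_nnsfun.
under [RHS]eq_integral do rewrite mono.
rewrite -monotone_convergence//.
- move=> n; apply: measurable_fun_integral_kernel => //.
    by move=> z; rewrite lee_fin.
  exact/measurable_EFinP.
- by move=> n x _; apply: integral_ge0 => z _; rewrite lee_fin.
- move=> x _ a b ab; apply: ge0_le_integral => //.
  + by move=> z _; rewrite lee_fin.
  + exact/measurable_EFinP.
  + exact/measurable_EFinP.
  + by move=> z _; rewrite lee_fin; exact/lefP/nd_nnsfun_approx.
Qed.

End integral_mixture.

Section density.
Context d (T : measurableType d) (R : realType).
Local Open Scope ereal_scope.

(** A measure of density [t] is the mixture of the measures
    [t(z) delta_z]. *)
Lemma ge0_integral_radon_nikodym (nu mu : {measure set T -> \bar R})
    (t : T -> R) (h : T -> \bar R) :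
  (forall z, (0 <= t z)%R) -> measurable_fun [set: T] t ->
  radon_nikodym_version nu mu t ->
  (forall z, 0 <= h z) -> measurable_fun [set: T] h ->
  \int[nu]_z h z = \int[mu]_z ((t z)%:E * h z).
Proof.
move=> t0 mt nut h0 mh.
pose k z : {measure set T -> \bar R} := mscale (NngNum (t0 z)) (dirac z).
rewrite (@ge0_integral_mixture _ _ _ _ _ mu nu k)//.
- apply: eq_integral => z _; rewrite ge0_integral_mscale//.
  by rewrite integral_dirac// diracT mul1e.
- move=> U mU; rewrite /k/= /mscale/=; apply: emeasurable_funM.
    exact/measurable_EFinP.
  by apply/measurable_EFinP; exact: measurable_indic.
- move=> U mU; rewrite nut// integral_mkcond; apply: eq_integral => z _.
  rewrite patchE /k/= /mscale/= diracE.
  by case: ifPn => _; rewrite ?mule1 ?mule0.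
Qed.
End density.

Section semidirect.
Context d (E : measurableType d) (R : realType).
Variables (pi : probability E R) (gamma : R.-pker E ~> E).
Local Open Scope ereal_scope.

Lemma ge0_integral_sdprod (h : E * E -> \bar R) :
  (forall z, 0 <= h z) -> measurable_fun [set: E * E] h ->
  \int[sdprod pi gamma]_z h z = \int[pi]_x \int[gamma x]_y h (x, y).
Proof.
move=> h0 mh.
(* The measure structure of a pushforward depends on the measurability of the
   map: [k_] abstracts over those proofs and [k] supplies them. *)
pose k_ x : {measure set (E * E) -> \bar R} := pushforward (gamma x) (pair x).
pose k := k_ (@pair1_measurable _ _ E E).
have kE x U : k x U = gamma x (xsection U x).
  by rewrite /k/k_/= /pushforward xsectionE.
rewrite (@ge0_integral_mixture _ _ _ _ _ pi _ k)//.
- apply: eq_integral => x _; rewrite ge0_integral_pushforward//.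
- move=> U mU; under eq_fun do rewrite kE.
  by apply: measurable_fun_xsection_finite_kernel; rewrite inE.
- by move=> U mU; apply: eq_integral => x _; rewrite kE.
Qed.

Let integral_section_posneg (h : E * E -> \bar R) x :
  \int[gamma x]_y h (x, y) =
  \int[gamma x]_y h^\+ (x, y) - \int[gamma x]_y h^\- (x, y).
Proof.
rewrite integralE; congr (_ - _); apply: eq_integral => y _.
  by rewrite !funeposE.
by rewrite !funenegE.
Qed.

(** Where the positive and the negative part of a section both have infinite
    integral, their difference takes a conventional value; subtraction of
    extended reals is measurable all the same. *)
Lemma measurable_integral_pker (h : E * E -> \bar R) :
  measurable_fun [set: E * E] h ->
  measurable_fun [set: E] (fun x => \int[gamma x]_y h (x, y)).
Proof.
move=> mh; rewrite (_ : (fun x => _) = (fun x =>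
    \int[gamma x]_y h^\+ (x, y) - \int[gamma x]_y h^\- (x, y))); last first.
  exact/funext/integral_section_posneg.
apply: emeasurable_funB; apply: measurable_fun_integral_finite_kernel => //.
  exact: measurable_funepos.
exact: measurable_funeneg.
Qed.

Lemma sdprod_integrable_section (h : E * E -> \bar R) :
  (sdprod pi gamma).-integrable [set: E * E] h ->
  {ae pi, forall x, (gamma x).-integrable [set: E] (fun y => h (x, y))}.
Proof.
move=> /integrableP[mh]; rewrite ge0_integral_sdprod//; last first.
  exact: measurableT_comp.
move=> hoo.
have /integrable_ae : pi.-integrable [set: E]
    (fun x => \int[gamma x]_y `|h (x, y)|).
  apply/integrableP; split.
    apply: (measurable_fun_integral_finite_kernel (abse \o h)) => //.
      by move=> z; exact: abse_ge0.
    exact: measurableT_comp.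
  under eq_integral do rewrite gee0_abs ?integral_ge0//.
  exact: hoo.
move=> /(_ measurableT); apply: filterS => x /(_ I) fx.
apply/integrableP; split; first exact: measurableT_comp.
by rewrite ltey_eq fx.
Qed.

Lemma integral_sdprod (h : E * E -> \bar R) :
  (sdprod pi gamma).-integrable [set: E * E] h ->
  \int[sdprod pi gamma]_z h z = \int[pi]_x \int[gamma x]_y h (x, y).
Proof.
move=> hi; have mh := measurable_int _ hi.
have part (f : E * E -> \bar R) : (forall z, 0 <= f z) ->
    (sdprod pi gamma).-integrable [set: E * E] f ->
    pi.-integrable [set: E] (fun x => \int[gamma x]_y f (x, y)).
  move=> f0 /integrableP[mf foo]; apply/integrableP; split.
    exact: measurable_fun_integral_finite_kernel.
  under eq_integral do rewrite gee0_abs ?integral_ge0//.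
  rewrite -ge0_integral_sdprod//.
  by under eq_integral do rewrite -[f _]gee0_abs//.
rewrite integralE !ge0_integral_sdprod//; last 2 first.
- exact: measurable_funeneg.
- exact: measurable_funepos.
rewrite -integralB//; last 2 first.
- by apply: part => //; exact: integrable_funepos.
- by apply: part => //; exact: integrable_funeneg.
by apply: eq_integral => x _; rewrite [RHS]integral_section_posneg.
Qed.

Lemma integrable_cst_pker x (r : R) :
  (gamma x).-integrable [set: E] (EFin \o cst r).
Proof.
apply/integrableP; split; first exact/measurable_EFinP.
by rewrite (eq_integral (cst `|r|%:E))// integral_cst// prob_kernel mule1 ltry.
Qed.

End semidirect.

(** * Symmetry of balanced rates *)

Section balanced_rates.
Context d (E : measurableType d) (R : realType).
Variables (pi : probability E R) (gamma : R.-pker E ~> E).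
Variables (t : E * E -> R) (g : R -> R).
Hypotheses (mt : measurable_fun [set: E * E] t) (t0 : forall z, 0 <= t z).
Hypothesis ratio_t : acceptance_ratio pi gamma t.
Hypothesis bal_g : balancing_function g.
Local Open Scope ereal_scope.

Lemma measurable_balanced_rate : measurable_fun [set: E * E] (g \o t).
Proof.
apply: measurable_comp (balancing_measurable bal_g) mt => //.
by move=> _ [z _ <-]/=; rewrite in_itv/= t0.
Qed.

(** On the set where [t(y, x) = 1 / t(x, y)] this is the balancing identity; off
    that set [t] vanishes, and so does [g \o t] since [g 0 = 0].  The equality
    thus holds everywhere, not only almost everywhere. *)
Lemma balanced_rate_detailed z : (t z * g (t (z.2, z.1)) = g (t z))%R.
Proof.
case: ratio_t => _ [S [_ _ tS tNS]]; case: z => x y /=.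
have [Sxy|NSxy] := pselect (S (x, y)).
  have [txy0 tyx] := tS _ _ Sxy.
  by rewrite tyx -(balancingE bal_g).
by rewrite tNS// mul0r (balancing0 bal_g).
Qed.

(** Detailed balance: exchanging the coordinates turns [mu] into [t mu], and the
    factor [t] is absorbed by [balanced_rate_detailed]. *)
Lemma symmetric_balanced_rate (h : E * E -> \bar R) :
  (forall z, 0 <= h z) -> measurable_fun [set: E * E] h ->
  \int[sdprod pi gamma]_z ((g (t z))%:E * h (z.2, z.1)) =
  \int[sdprod pi gamma]_z ((g (t z))%:E * h z).
Proof.
move=> h0 mh.
have g0 z : (0 <= g (t z))%R by exact: balancing_ge0.
have mgt : measurable_fun [set: E * E] (fun z => (g (t z))%:E).
  by apply/measurable_EFinP; exact: measurable_balanced_rate.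
pose nu_ : {measure set (E * E) -> \bar R} :=
  pushforward (sdprod pi gamma) (fun z => (z.2, z.1)).
pose nu := nu_ (@measurable_swap _ _ E E).
have mgs : measurable_fun [set: E * E] (fun z => (g (t (z.2, z.1)))%:E).
  exact: (measurableT_comp mgt (@measurable_swap _ _ E E)).
have mH := emeasurable_funM mgs mh.
have H0 z : 0 <= (g (t (z.2, z.1)))%:E * h z by rewrite mule_ge0// lee_fin.
transitivity (\int[nu]_z ((g (t (z.2, z.1)))%:E * h z)).
  rewrite ge0_integral_pushforward//; last exact: (@measurable_swap _ _ E E).
  by apply: eq_integral => -[x y] _.
rewrite (@ge0_integral_radon_nikodym _ _ _ nu (sdprod pi gamma) t)//.
- by apply: eq_integral => z _; rewrite muleA -EFinM balanced_rate_detailed.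
- by case: ratio_t.
Qed.

End balanced_rates.

(** * Energy of a reversible jump process *)

(** The measure [c(x, y) pi(dx) gamma(x, dy)] is symmetric, tested against
    nonnegative functions, whose integrals always make sense. *)
Definition reversible_rate d (E : measurableType d) (R : realType)
    (pi : probability E R) (gamma : R.-pker E ~> E) (c : E * E -> R) : Prop :=
  forall h : E * E -> \bar R,
    (forall z, (0 <= h z)%E) -> measurable_fun [set: E * E] h ->
    (\int[sdprod pi gamma]_z ((c z)%:E * h (z.2, z.1)) =
     \int[sdprod pi gamma]_z ((c z)%:E * h z))%E.

Definition jump_generator d (E : measurableType d) (R : realType)
    (gamma : R.-pker E ~> E) (c : E * E -> R) (f : E -> R) (x : E) : R :=
  \int[gamma x]_y ((f y - f x) * c (x, y)).

Definition jump_energy d (E : measurableType d) (R : realType)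
    (pi : probability E R) (gamma : R.-pker E ~> E) (c : E * E -> R)
    (f : E -> R) : R :=
  \int[sdprod pi gamma]_z (c z * (f z.2 - f z.1) ^+ 2).

Section jump_energy.
Context d (E : measurableType d) (R : realType).
Variables (pi : probability E R) (gamma : R.-pker E ~> E).
Variables (c : E * E -> R) (C : R).
Hypotheses (mc : measurable_fun [set: E * E] c) (c0 : forall z, 0 <= c z).
Hypothesis (cC : forall z, c z <= C).
Hypothesis rev_c : reversible_rate pi gamma c.
Variable f : E -> R.
Hypothesis f2 : f \in Lfun pi 2%:E.

Local Notation mu := (sdprod pi gamma).

Lemma measurable_Lfun : measurable_fun [set: E] f.
Proof. by move: f2; rewrite inE => /andP[]; rewrite inE. Qed.
Let mf := measurable_Lfun.

Let mf1 : measurable_fun [set: E * E] (fun z => f z.1).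
Proof. exact: measurableT_comp. Qed.

Let mf2 : measurable_fun [set: E * E] (fun z => f z.2).
Proof. exact: measurableT_comp. Qed.

Let mf1sq : measurable_fun [set: E * E] (fun z => f z.1 ^+ 2).
Proof. exact: measurable_funX. Qed.

Let mf2sq : measurable_fun [set: E * E] (fun z => f z.2 ^+ 2).
Proof. exact: measurable_funX. Qed.

Let integrable_sq1 : mu.-integrable [set: E * E]
  (EFin \o (fun z => c z * f z.1 ^+ 2)).
Proof.
have sq : mu.-integrable [set: E * E] (EFin \o (fun z => f z.1 ^+ 2)).
  have /integrableP[mff foo] := Lfun2_integrable_sqr f2.
  apply/integrableP; split; first exact/measurable_EFinP.
  apply: le_lt_trans foo; rewrite ge0_integral_sdprod//; last first.
    by apply: measurableT_comp => //; exact/measurable_EFinP.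
  rewrite le_eqVlt; apply/orP; left; apply/eqP/eq_integral => x _ /=.
  by rewrite integral_cst// prob_kernel mule1.
have Csq := integrableZl measurableT C sq.
apply: le_integrable Csq => //.
  by apply/measurable_EFinP; exact: measurable_funM.
move=> z _; rewrite /= lee_fin !normrM (ger0_norm (c0 z)).
by rewrite ler_wpM2r// (le_trans (cC z))// ler_norm.
Qed.

Let ge0_sq1 z : 0 <= c z * f z.1 ^+ 2.
Proof. by rewrite mulr_ge0// sqr_ge0. Qed.

Let ge0_sq2 z : 0 <= c z * f z.2 ^+ 2.
Proof. by rewrite mulr_ge0// sqr_ge0. Qed.

Let integral_sq : (\int[mu]_z (c z * f z.2 ^+ 2)%:E =
  \int[mu]_z (c z * f z.1 ^+ 2)%:E)%E.
Proof.
under eq_integral do rewrite EFinM.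
under [RHS]eq_integral do rewrite EFinM.
apply: (rev_c (h := fun z => (f z.1 ^+ 2)%:E)).
  by move=> z; rewrite lee_fin sqr_ge0.
exact/measurable_EFinP.
Qed.

Let integrable_sq2 : mu.-integrable [set: E * E]
  (EFin \o (fun z => c z * f z.2 ^+ 2)).
Proof.
have /integrableP[_ foo] := integrable_sq1.
apply/integrableP; split.
  by apply/measurable_EFinP; exact: measurable_funM.
under eq_integral do rewrite /= ger0_norm ?ge0_sq2//.
rewrite integral_sq; apply: le_lt_trans foo.
by under [leRHS]eq_integral do rewrite /= ger0_norm ?ge0_sq1//.
Qed.

Let integrable_prod : mu.-integrable [set: E * E]
  (EFin \o (fun z => c z * (f z.1 * f z.2))).
Proof.
apply: le_integrable
  (integrableD measurableT integrable_sq1 integrable_sq2) => //.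
  apply/measurable_EFinP; apply: measurable_funM => //.
  exact: measurable_funM.
move=> z _; rewrite /= lee_fin -mulrDr !normrM.
rewrite ler_wpM2l// [leRHS]ger0_norm ?addr_ge0 ?sqr_ge0//.
rewrite -(real_normK (num_real (f z.1))) -(real_normK (num_real (f z.2))).
have := sqr_ge0 (`|f z.1| - `|f z.2|).
have : 0 <= `|f z.1| * `|f z.2| by rewrite mulr_ge0.
by nra.
Qed.

(** Domination by [c (1 + f(x)^2 + f(y)^2)], where the term in [f(y)] is
    integrable because reversibility turns it into the term in [f(x)].  This
    makes the generator a genuine integral at almost every point. *)
Lemma jump_integrable : mu.-integrable [set: E * E]
  (EFin \o (fun z => (f z.2 - f z.1) * c z)).
Proof.
have /(integrableD measurableT) : mu.-integrable [set: E * E] (EFin \o cst C).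
  exact: finite_measure_integrable_cst.
move=> /(_ _ (integrableD measurableT integrable_sq1 integrable_sq2)).
apply: le_integrable => //.
  apply/measurable_EFinP; apply: measurable_funM => //.
  exact: measurable_funB.
move=> z _; rewrite /= lee_fin !normrM (ger0_norm (c0 z)).
apply: le_trans (ler_norm _).
apply: (@le_trans _ _ (c z + (c z * f z.1 ^+ 2 + c z * f z.2 ^+ 2)));
  last first.
  by rewrite lerD2r.
rewrite -!mulrDr -{2}(mulr1 (c z)) -mulrDr mulrC ler_wpM2l//.
apply: (le_trans (ler_normB _ _)).
rewrite -(real_normK (num_real (f z.1))) -(real_normK (num_real (f z.2))).
have := sqr_ge0 (`|f z.1| - 1); have := sqr_ge0 (`|f z.2| - 1).
by nra.
Qed.

Lemma jump_energy_integrable : mu.-integrable [set: E * E]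
  (EFin \o (fun z => c z * (f z.2 - f z.1) ^+ 2)).
Proof.
have := integrableD measurableT integrable_sq1 integrable_sq2.
move=> /(integrableB measurableT)
  /(_ (integrableZl measurableT 2 integrable_prod)).
apply: eq_integrable => // z _ /=; 
by congr EFin; ring.
Qed.

(** The left side is [\int c (f(x)^2 - f(x) f(y)) dmu] by Fubini.  By
    reversibility [f(x)^2] and [f(y)^2] have the same integral against [c mu],
    so this is half of [\int c (f(x)^2 + f(y)^2 - 2 f(x) f(y)) dmu]. *)
Lemma dirichlet_jump_generator :
  dirichlet_generator pi (jump_generator gamma c) f =
  2^-1 * jump_energy pi gamma c f.
Proof.
have iF : mu.-integrable [set: E * E]
    (EFin \o (fun z => c z * f z.1 ^+ 2 - c z * (f z.1 * f z.2))).
  by have := integrableB measurableT integrable_sq1 integrable_prod.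
transitivity (\int[mu]_z (c z * f z.1 ^+ 2 - c z * (f z.1 * f z.2))).
  rewrite /dirichlet_generator /inner /jump_generator /Rintegral.
  rewrite integral_sdprod//; congr fine; apply: ae_eq_integral => //.
  - apply/measurable_EFinP; apply: measurable_funM => //.
    apply: measurableT_comp => //; apply: measurableT_comp => //.
    apply: (@measurable_integral_pker _ _ _ gamma
      (fun z => ((f z.2 - f z.1) * c z)%:E)).
    exact: measurable_int jump_integrable.
  - exact: (measurable_integral_pker gamma (measurable_int _ iF)).
  - apply: filterS (sdprod_integrable_section jump_integrable) => x ix _ /=.
    rewrite mulrN -mulNr EFinM fineK; last exact: integrable_fin_num.
    rewrite -integralZl//; apply: eq_integral => y _ /=.
    by rewrite -EFinM; congr EFin; ring.
rewrite RintegralB// /jump_energy.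
rewrite [in RHS](@eq_Rintegral _ _ _ mu _
  (fun z => (c z * f z.1 ^+ 2 + c z * f z.2 ^+ 2) -
    2 * (c z * (f z.1 * f z.2)))); last by move=> z _ /=; ring.
rewrite RintegralB//; last 2 first.
- exact: (integrableD measurableT integrable_sq1 integrable_sq2).
- exact: (integrableZl measurableT 2 integrable_prod).
rewrite RintegralD// RintegralZl//.
have -> : \int[mu]_z (c z * f z.2 ^+ 2) = \int[mu]_z (c z * f z.1 ^+ 2).
  by rewrite /Rintegral integral_sq.
by field.
Qed.

End jump_energy.

(** * The Metropolis-Hastings chain as a jump process *)

Section metropolis_hastings_form.
Context d (E : measurableType d) (R : realType).
Variables (gamma : R.-pker E ~> E) (t : E * E -> R).
Hypotheses (mt : measurable_fun [set: E * E] t) (t0 : forall z, 0 <= t z).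

Definition mh_rate (z : E * E) : R := Num.min 1 (t z).

Local Notation a := mh_rate.
Local Notation P := (mh_kernel gamma mt t0).

Lemma measurable_mh_rate : measurable_fun [set: E * E] a.
Proof. exact: measurable_minr. Qed.

Lemma mh_rate_ge0 z : 0 <= a z.
Proof. by rewrite /a le_min ler01 t0. Qed.

Lemma mh_rate_le1 z : a z <= 1.
Proof. by rewrite /a ge_min lexx. Qed.

Let ma1 x : measurable_fun [set: E] (fun y => a (x, y)).
Proof. exact: measurableT_comp measurable_mh_rate _. Qed.

Let mrej x : measurable_fun [set: E] (fun y => 1 - a (x, y)).
Proof. exact: measurable_funB. Qed.

(** [P(x, .)] is the mixture, over the proposal [y], of
    [a(x, y) delta_y + (1 - a(x, y)) delta_x]: accept, or stay. *)
Lemma ge0_integral_mh x (h : E -> R) :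
  (forall y, 0 <= h y) -> measurable_fun [set: E] h ->
  (\int[P x]_y (h y)%:E =
   \int[gamma x]_y (a (x, y) * h y + (1 - a (x, y)) * h x)%:E)%E.
Proof.
move=> h0 mh.
have a1 y : 0 <= 1 - a (x, y) by rewrite subr_ge0 mh_rate_le1.
pose k y : {measure set E -> \bar R} :=
  measure_add (mscale (NngNum (mh_rate_ge0 (x, y))) (dirac y))
              (mscale (NngNum (a1 y)) (dirac x)).
have mhE : measurable_fun [set: E] (EFin \o h) by exact/measurable_EFinP.
have kE y U : k y U = ((a (x, y))%:E * \d_y U + (1 - a (x, y))%:E * \d_x U)%E.
  exact: measure_addE.
rewrite (@ge0_integral_mixture _ _ _ _ _ (gamma x) _ k)//.
- apply: eq_integral => y _.
  have h0E z : [set: E] z -> (0 <= (h z)%:E)%E by rewrite lee_fin.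
  rewrite ge0_integral_measure_add// !ge0_integral_mscale//.
  by rewrite !integral_dirac// !diracT !mul1e.
- move=> U mU; rewrite (funext (kE ^~ U)).
  apply: emeasurable_funD; apply: emeasurable_funM => //.
  + exact/measurable_EFinP.
  + by apply/measurable_EFinP; exact: measurable_indic.
  + exact/measurable_EFinP.
- move=> U mU; under [RHS]eq_integral do rewrite kE.
  rewrite ge0_integralD//; last 4 first.
  + by move=> y _; rewrite mule_ge0// lee_fin mh_rate_ge0.
  + apply: emeasurable_funM; first exact/measurable_EFinP.
    by apply/measurable_EFinP; exact: measurable_indic.
  + by move=> y _; rewrite mule_ge0// lee_fin.
  + by apply: emeasurable_funM => //; exact/measurable_EFinP.
  rewrite ge0_integralZr//; last 2 first.
  + exact/measurable_EFinP.
  + by move=> y _; rewrite lee_fin.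
  congr (_ + _)%E; rewrite integral_mkcond; apply: eq_integral => y _.
  by rewrite patchE diracE; case: ifPn => _; rewrite ?mule1 ?mule0.
Qed.

Section signed.
Variables (x : E) (f : E -> R).
Hypothesis mf : measurable_fun [set: E] f.
Hypothesis fi : (gamma x).-integrable [set: E]
  (EFin \o (fun y => (f y - f x) * a (x, y))).

(* The bound is [|f x| + |(f y - f x) a(x, y)|], from
   [|f y| <= |f y - f x| + |f x|] and [0 <= a <= 1]. *)
Let integrable_dominated (h : E -> R) :
  (forall y, 0 <= h y <= `|f y|) -> measurable_fun [set: E] h ->
  (gamma x).-integrable [set: E]
    (EFin \o (fun y => a (x, y) * h y + (1 - a (x, y)) * h x)).
Proof.
move=> hf mh.
have ifx : (gamma x).-integrable [set: E] (EFin \o cst (f x)).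
  exact: integrable_cst_pker.
apply: le_integrable
    (integrableD measurableT (integrable_abse ifx) (integrable_abse fi)) => //.
  apply/measurable_EFinP; apply: measurable_funD; first exact: measurable_funM.
  exact: measurable_funM.
move=> y _; rewrite /= lee_fin.
have A0 := mh_rate_ge0 (x, y); have A1 := mh_rate_le1 (x, y).
have [/andP[hx0 hx] /andP[hy0 hy]] := (hf x, hf y).
have B0 : 0 <= 1 - a (x, y) by rewrite subr_ge0.
rewrite [leLHS]ger0_norm ?addr_ge0 ?mulr_ge0//.
rewrite [leRHS]ger0_norm ?addr_ge0// normrM (ger0_norm A0).
have fyx : `|f y| <= `|f y - f x| + `|f x|.
  by rewrite (le_trans _ (ler_normD _ _))// subrK.
have := ler_wpM2l A0 (le_trans hy fyx).
have := ler_wpM2l B0 hx.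
by rewrite !mulrDr !mulrBl !mul1r [a _ * `|_ - _|]mulrC; lra.
Qed.

Let Rintegral_mh_ge0 (h : E -> R) :
  (forall y, 0 <= h y <= `|f y|) -> measurable_fun [set: E] h ->
  (P x).-integrable [set: E] (EFin \o h) /\
  \int[P x]_y h y =
    \int[gamma x]_y (a (x, y) * h y + (1 - a (x, y)) * h x).
Proof.
move=> hf mh; have h0 y : 0 <= h y by case/andP: (hf y).
split; last by rewrite /Rintegral ge0_integral_mh.
apply/integrableP; split; first exact/measurable_EFinP.
under eq_integral do rewrite /= ger0_norm//.
by rewrite ge0_integral_mh//; exact/integrable_lty/integrable_dominated.
Qed.

(** Rejection contributes no increment, so [P f - f] is the jump generator of
    rate [a].  The integral is split into positive and negative parts because
    the disintegration is known for nonnegative functions. *)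
Lemma Rintegral_mh : \int[P x]_y f y = f x + jump_generator gamma a f x.
Proof.
pose fp y := Num.max (f y) 0; pose fn y := Num.max (- f y) 0.
have fpn y : f y = fp y - fn y.
  by rewrite /fp /fn; case: (leP (f y) 0); case: (leP (- f y) 0); lra.
have fpP y : 0 <= fp y <= `|f y|.
  by rewrite le_max lexx orbT ge_max ler_norm normr_ge0.
have fnP y : 0 <= fn y <= `|f y|.
  by rewrite le_max lexx orbT ge_max -normrN ler_norm normr_ge0.
have mfp : measurable_fun [set: E] fp by exact: measurable_maxr.
have mfn : measurable_fun [set: E] fn.
  by apply: measurable_maxr => //; exact: measurableT_comp.
have [ip Ep] := Rintegral_mh_ge0 fpP mfp.
have [in_ En] := Rintegral_mh_ge0 fnP mfn.
rewrite (@eq_Rintegral _ _ _ (P x) _ (fun y => fp y - fn y)); last first.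
  by move=> y _ /=; exact: fpn.
rewrite RintegralB// Ep En -RintegralB//; last 2 first.
- exact: integrable_dominated.
- exact: integrable_dominated.
rewrite (@eq_Rintegral _ _ _ _ _ (fun y => f x + (f y - f x) * a (x, y))).
  rewrite RintegralD//; last exact: integrable_cst_pker.
  by rewrite Rintegral_cst// prob_kernel mulr1.
by move=> y _ /=; rewrite !fpn; ring.
Qed.

End signed.

(** For [f] in [L^2(pi)] the hypothesis of [Rintegral_mh] holds only at almost
    every [x], which is enough under the integral. *)
Lemma dirichlet_kernel_mh (pi : probability E R) (f : E -> R) :
  reversible_rate pi gamma a -> f \in Lfun pi 2%:E ->
  dirichlet_kernel pi P f = dirichlet_generator pi (jump_generator gamma a) f.
Proof.
move=> rev_a f2; have mf := measurable_Lfun f2.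
have ji := jump_integrable measurable_mh_rate mh_rate_ge0 mh_rate_le1 rev_a f2.
rewrite /dirichlet_kernel /dirichlet_generator /inner /Rintegral.
congr fine; apply: ae_eq_integral => //.
- apply/measurable_EFinP; apply: measurable_funM => //.
  apply: measurable_funB => //.
  apply: measurableT_comp => //.
  apply: (@measurable_integral_pker _ _ _ P (fun z => (f z.2)%:E)).
  by apply/measurable_EFinP; exact: measurableT_comp.
- apply/measurable_EFinP; apply: measurable_funM => //.
  apply: measurableT_comp => //; apply: measurableT_comp => //.
  exact: (measurable_integral_pker gamma (measurable_int _ ji)).
- apply: filterS (sdprod_integrable_section ji) => x ix _ /=.
  congr (_ * _)%:E.
  by rewrite -/(Rintegral _ _ _) Rintegral_mh// opprD addrA subrr add0r.
Qed.

End metropolis_hastings_form.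

(** * Poincare infima *)

Lemma bounded_measurable_Lfun2 d (E : measurableType d) (R : realType)
    (pi : probability E R) (f : E -> R) :
  bounded_measurable f -> f \in Lfun pi 2%:E.
Proof.
move=> [mf [M [_ Mf]]]; pose B : R := `|M| + 1.
have fB y : `|f y| <= B by apply: Mf => //; rewrite ltr_pwDr// ler_norm.
rewrite inE; apply/andP; rewrite !inE/=; split=> //.
rewrite /finite_norm unlock poweR_lty//.
have /integrable_lty : pi.-integrable [set: E] (EFin \o cst (B `^ 2)).
  exact: finite_measure_integrable_cst.
move=> /(_ measurableT); apply: le_lt_trans; apply: ge0_le_integral => //.
- by move=> x _; rewrite lee_fin powR_ge0.
- apply/measurable_EFinP; apply: (measurableT_comp (measurable_powR _)) => //.
  exact: measurableT_comp.
- exact/measurable_EFinP.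
- move=> x _; rewrite /= lee_fin ge0_ler_powR ?nnegrE//.
  exact: le_trans (fB x).
Qed.

(** The infimum may be [+oo] (no function of positive variance), so the argument
    runs through a real lower bound [e > 0] of the first quotient, which gives
    the lower bound [e / C] of the second. *)
Lemma poincare_inf_gt0 d (E : measurableType d) (R : realType)
    (pi : probability E R) (form1 form2 : (E -> R) -> R) (F : set (E -> R))
    (C : R) :
  0 < C -> (forall f, F f -> f \in Lfun pi 2%:E) ->
  (forall f, F f -> form1 f <= C * form2 f) ->
  (0 < poincare_inf pi form1 F)%E -> (0 < poincare_inf pi form2 F)%E.
Proof.
move=> C0 F2 le12 gap1.
have [e e0 egap] : exists2 e : R, 0 < e & (e%:E <= poincare_inf pi form1 F)%E.
  case: poincare_inf gap1 => [r||//]; last by move=> _; exists 1; rewrite ?leey.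
  by rewrite lte_fin => r0; exists r.
apply: (@lt_le_trans _ _ (e / C)%:E); first by rewrite lte_fin divr_gt0.
apply/ereal_infP => _ [f [Ff vf] <-]; rewrite lee_fin.
have v0 : 0 < fine (variance pi f).
  by rewrite fine_gt0// vf ltey_eq variance_fin_num// F2.
have : (e%:E <= (form1 f / fine (variance pi f))%:E)%E.
  by apply: le_trans egap _; apply: ereal_inf_lbound; exists f.
rewrite lee_fin !ler_pdivlMr// => h.
rewrite mulrAC ler_pdivrMr// [leRHS]mulrC; exact: le_trans h (le12 _ Ff).
Qed.

(** * Comparison with the Metropolis rate *)

Section balancing_bounds.
Context (R : realType).

Lemma balancing_min : balancing_function (Num.min 1 : R -> R).
Proof.
split.
- exact: measurable_minr.
- by move=> s s0; rewrite le_min ler01.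
- by rewrite minxx.
- by apply/min_idPr.
- by move=> s s0; rewrite lt_min ltr01.
- move=> s s0; rewrite minr_pMr; last exact: ltW.
  by rewrite mulr1 mulrCA divff ?gt_eqF// mulr1 minC.
Qed.

Variables (g : R -> R) (lambda : R).
Hypothesis bal_g : balancing_function g.
Hypothesis nd_g : forall r s : R, 0 <= r -> r <= s -> g r <= g s.
Hypothesis g_le : forall s : R, 0 <= s -> g s <= lambda.

(** For [s >= 1], [g(s) >= g(1) = 1]; for [0 < s < 1],
    [g(s) = s g(1/s) >= s g(1) = s]. *)
Lemma balancing_ge_min s : 0 <= s -> Num.min 1 s <= g s.
Proof.
rewrite le_eqVlt => /predU1P[<-|s0].
  by rewrite (balancing0 bal_g) ge_min lexx orbT.
have [s1|s1] := leP 1 s; first by rewrite -[leLHS](balancing1 bal_g) nd_g.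
rewrite (balancingE bal_g s0) ler_peMr//; first exact: ltW.
rewrite -[leLHS](balancing1 bal_g).
by rewrite nd_g// ltW// div1r invf_gt1.
Qed.

(** For [s < 1] the bound [lambda] is applied at [1/s] through
    [g(s) = s g(1/s)]. *)
Lemma balancing_le_min s : 0 <= s -> g s <= lambda * Num.min 1 s.
Proof.
rewrite le_eqVlt => /predU1P[<-|s0].
  by rewrite (balancing0 bal_g) (min_idPr _)// mulr0.
have [s1|s1] := leP 1 s; first by rewrite mulr1 g_le// ltW.
rewrite (balancingE bal_g s0) mulrC ler_wpM2r//; first exact: ltW.
by rewrite g_le// divr_ge0// ltW.
Qed.

Lemma balancing_bound_ge1 : 1 <= lambda.
Proof. by rewrite -(balancing1 bal_g) g_le. Qed.

End balancing_bounds.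

Lemma le_jump_energy d (E : measurableType d) (R : realType)
    (pi : probability E R) (gamma : R.-pker E ~> E) (c1 c2 : E * E -> R)
    (C : R) (f : E -> R) :
  (forall z, c1 z <= C * c2 z) ->
  (sdprod pi gamma).-integrable [set: E * E]
    (EFin \o (fun z => c1 z * (f z.2 - f z.1) ^+ 2)) ->
  (sdprod pi gamma).-integrable [set: E * E]
    (EFin \o (fun z => c2 z * (f z.2 - f z.1) ^+ 2)) ->
  jump_energy pi gamma c1 f <= C * jump_energy pi gamma c2 f.
Proof.
move=> c12 i1 i2; rewrite /jump_energy -RintegralZl//.
apply: le_Rintegral => //; first exact: (integrableZl measurableT C i2).
by move=> z _; rewrite mulrA ler_wpM2r ?sqr_ge0.
Qed.

Section comparison.
Context d (E : measurableType d) (R : realType).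
Variables (pi : probability E R) (gamma : R.-pker E ~> E) (t : E * E -> R).
Hypotheses (mt : measurable_fun [set: E * E] t) (t0 : forall z, 0 <= t z).
Hypothesis ratio_t : acceptance_ratio pi gamma t.
Variables (g : R -> R) (lambda : R).
Hypothesis bal_g : balancing_function g.
Hypothesis nd_g : forall r s : R, 0 <= r -> r <= s -> g r <= g s.
Hypothesis g_le : forall s : R, 0 <= s -> g s <= lambda.

Lemma dirichlet_comparison (f : E -> R) : f \in Lfun pi 2%:E ->
  dirichlet_kernel pi (mh_kernel gamma mt t0) f <=
    dirichlet_generator pi (lb_generator gamma t g) f <=
    lambda * dirichlet_kernel pi (mh_kernel gamma mt t0) f.
Proof.
move=> f2.
have rev_g : reversible_rate pi gamma (g \o t).
  by move=> h; exact: symmetric_balanced_rate.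
have rev_a : reversible_rate pi gamma (mh_rate t).
  by move=> h; exact: (symmetric_balanced_rate mt t0 ratio_t (balancing_min R)).
have mgt := measurable_balanced_rate mt t0 bal_g.
have g0 z : 0 <= (g \o t) z by exact: balancing_ge0.
have gl z : (g \o t) z <= lambda by exact: g_le.
have ma := measurable_mh_rate mt.
have a0 := mh_rate_ge0 t0; have a1 := mh_rate_le1 t.
have ig := jump_energy_integrable mgt g0 gl rev_g f2.
have ia := jump_energy_integrable ma a0 a1 rev_a f2.
rewrite dirichlet_kernel_mh// (dirichlet_jump_generator ma a0 a1 rev_a f2).
rewrite [dirichlet_generator _ _ _]
  (dirichlet_jump_generator mgt g0 gl rev_g f2).
rewrite mulrCA !ler_pM2l ?invr_gt0//; apply/andP; split.
- rewrite -[leRHS]mul1r; apply: le_jump_energy => // z.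
  by rewrite mul1r; exact: balancing_ge_min.
- by apply: le_jump_energy => // z; exact: balancing_le_min.
Qed.

Lemma gap_equivalence (F : set (E -> R)) :
  (forall f, F f -> f \in Lfun pi 2%:E) ->
  (0 < poincare_inf pi
    (dirichlet_generator pi (lb_generator gamma t g)) F)%E <->
  (0 < poincare_inf pi (dirichlet_kernel pi (mh_kernel gamma mt t0)) F)%E.
Proof.
move=> F2; have lambda0 : 0 < lambda.
  by rewrite (lt_le_trans ltr01)// (balancing_bound_ge1 bal_g).
split;
  [apply: (poincare_inf_gt0 lambda0 F2)|apply: (poincare_inf_gt0 ltr01 F2)].
- by move=> f /F2 /dirichlet_comparison/andP[].
- by move=> f /F2 /dirichlet_comparison/andP[+ _]; rewrite mul1r.
Qed.

End comparison.

Unset Implicit Arguments.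

Theorem proposition3p2 (R : realType) (E : ptopologicalType)
    (polishE : polish_space R E)
    (pi : probability (borel E) R) (gamma : R.-pker borel E ~> borel E)
    (t : borel E * borel E -> R)
    (mt : measurable_fun [set: borel E * borel E] t)
    (t0 : forall z, 0 <= t z)
    (ratio_t : acceptance_ratio pi gamma t)
    (g : R -> R) (bal_g : balancing_function g)
    (nd_g : forall r s : R, 0 <= r -> r <= s -> g r <= g s)
    (lambda : R) (g_le : forall s : R, 0 <= s -> g s <= lambda) :
  ((0 < gap_generator pi (lb_generator gamma t g))%E <->
   (0 < gap_kernel pi (mh_kernel gamma mt t0))%E) /\
  ((0 < gapL2_generator pi (lb_generator gamma t g))%E <->
   (0 < gapL2_kernel pi (mh_kernel gamma mt t0))%E).
Proof.
split; apply: (gap_equivalence mt t0 ratio_t bal_g nd_g g_le) => //.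
exact: bounded_measurable_Lfun2.
Qed.
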